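(* Let $X$ be an infinite-dimensional complex Banach space, let $T$ be a bounded linear operator on $X$, and let $F$ be a (bounded) finite rank operator on $X$ such that $TF=FT$. Then $$\sigma_{rgD}(T+F)=\sigma_{rgD}(T).$$
   Context: The quasinilpotent part of a bounded operator $S$ on $X$ is $H_0(S)=\{x\in X:\lim_{n\to\infty}\|S^nx\|^{1/n}=0\}$. The analytical core $K(S)$ is the set of all $x\in X$ for which there exist a sequence $(x_n)_{n\ge1}$ in $X$ and a constant $\delta>0$ such that $Sx_1=x$, $Sx_{n+1}=x_n$ and $\|x_n\|\le\delta^n\|x\|$ for all $n\in\mathbb{N}$. $S$ is right generalized Drazin invertible if $K(S)$ is closed and there is a closed subspace $N$ of $X$ with $X=K(S)\oplus N$ and $S(N)\subset N\subseteq H_0(S)$. The right generalized Drazin spectrum is $\sigma_{rgD}(S)=\{\lambda\in\mathbb{C}:\lambda I-S\text{ is not right generalized Drazin invertible}\}$. *)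

(* Defs.v *)
From HB Require Import structures.
From mathcomp Require Import all_boot all_order all_algebra.
From mathcomp Require Import all_classical all_reals all_analysis.
From mathcomp.real_closed Require Import complex.

Set Implicit Arguments.
Unset Strict Implicit.
Unset Printing Implicit Defensive.

Import Order.TTheory GRing.Theory Num.Theory.
Import numFieldNormedType.Exports.

Local Open Scope classical_set_scope.
Local Open Scope ring_scope.

Section RightGeneralizedDrazin.
Context {R : realType} {X : completeNormedModType R[i]}.

(* The norm of a normed module over R[i] is R[i]-valued (with real values);
   [rnorm] is the same norm with values in R. *)
Definition rnorm (x : X) : R := complex.Re `|x|.

Definition bounded_operator (S : {linear X -> X}) : Prop :=
  exists M : R, forall x : X, rnorm (S x) <= M * rnorm x.

(* For a linear subspace A: A is spanned by finitely many of its vectors. *)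
Definition finite_dimensional (A : set X) : Prop :=
  exists (n : nat) (e : 'I_n -> X),
    (forall i, A (e i)) /\
    (forall x, A x -> exists c : 'I_n -> R[i], x = \sum_(i < n) c i *: e i).

Definition finite_rank (S : {linear X -> X}) : Prop :=
  finite_dimensional (range S).

Definition closed_subspace (N : set X) : Prop :=
  submod_closed (mem N) /\ closed N.

(* The whole space is the (algebraic) direct sum of the subspaces A and B. *)
Definition direct_sum (A B : set X) : Prop :=
  (forall x, exists a b, [/\ A a, B b & x = a + b]) /\ A `&` B = [set 0].

Definition quasinilpotent_part (S : X -> X) : set X :=
  [set x | (rnorm (iter n S x) `^ n%:R^-1) @[n --> \oo] --> (0 : R)].

(* The sequence is indexed from 1: the value u 0 plays no role. *)
Definition analytical_core (S : X -> X) : set X :=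
  [set x | exists (u : nat -> X) (delta : R),
    [/\ 0 < delta,
        S (u 1%N) = x,
        forall n, (1 <= n)%N -> S (u n.+1) = u n &
        forall n, (1 <= n)%N -> rnorm (u n) <= delta ^+ n * rnorm x]].

Definition right_generalized_Drazin_invertible (S : X -> X) : Prop :=
  closed (analytical_core S) /\
  exists N : set X,
    [/\ closed_subspace N,
        direct_sum (analytical_core S) N,
        S @` N `<=` N &
        N `<=` quasinilpotent_part S].

Definition rgD_spectrum (S : X -> X) : set R[i] :=
  [set lambda |
    ~ right_generalized_Drazin_invertible (fun x => lambda *: x - S x)].

End RightGeneralizedDrazin.

(* Main.v *)
Require Import Defs.
From HB Require Import structures.
From mathcomp Require Import all_boot all_order all_algebra.
From mathcomp Require Import all_classical all_reals all_analysis.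
From mathcomp.real_closed Require Import complex.
From mathcomp Require Import ring lra.

Set Implicit Arguments.
Unset Strict Implicit.
Unset Printing Implicit Defensive.

Import Order.TTheory GRing.Theory Num.Theory.
Import numFieldNormedType.Exports.

Local Open Scope classical_set_scope.
Local Open Scope ring_scope.

(** Put [S = lambda - T]; since [T + F] and [T] play symmetric roles ([F] may be
    replaced by [- F]), it suffices to show that if [S] is right generalized
    Drazin invertible and [F] has finite rank and commutes with [S], then
    [A = S + F] is right generalized Drazin invertible. Let [X = K(S) + N] be the
    given decomposition.

    Fitting's decomposition of [F] splits [X] into the kernel of [F^p], on which
    [F] is nilpotent, and the finite dimensional range of [F^p], through a
    bounded projection [Q] commuting with everything that commutes with [F]
    ([finite_rank_projection]). Where [F^p] vanishes, [S^p] is divisible by [A]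
    and [A^p] by [S], so the analytical cores of [S] and [A] have the same
    points there ([core_on_nilpotent_part]). On the finite dimensional range
    Fitting's decomposition of [A] leaves an invertible and a nilpotent part.
    The set [perturbed_core] of the vectors whose two components lie in [K(S)]
    and in that invertible part is closed, contained in [K(A)], and mapped onto
    itself by [A].

    The given complement [N] need not be invariant under [F], so a new one is
    built. Start from the intersection of [N] and the kernel of [F], on which
    [A] and [S] agree ([kernel_part_complement]). For [n] in [N] the vector
    [F n] is quasinilpotent for [S] and lies in the finite dimensional range of
    [F], so some power of [S] kills it: hence [S^d n] is in that intersection,
    and consequently [A] is nilpotent modulo the sum of [perturbed_core] and the
    intersection ([iter_in_sumset]), a sum which has finite codimension. A vector
    [z] with [A z] in this sum can be corrected by an element of [perturbed_core]
    so that [A z] falls into the intersection itself, because [A] maps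
    [perturbed_core] onto itself; adjoining the corrected vectors one at a time
    ([partial_complement_step]) yields a closed invariant complement on which [A]
    is quasinilpotent.

    Finally [K(A)] is no larger than [perturbed_core]
    ([geometric_core_perturbed]): if [b] belongs to [K(A)] and to the new
    complement, pull [b] back along its orbit by a power of [A] that maps the new
    complement into the old intersection. Then [b] lies in that intersection, so
    it is a common element of [K(S)] and [N], that is, zero. *)

(** * The real-valued norm *)
Section Basics.
Context {R : realType} {X : completeNormedModType R[i]}.
Implicit Types (x y z : X) (N M : set X) (B S F G : X -> X).

Lemma ger0_Re (a : R[i]) : 0 <= a -> a = (complex.Re a)%:C%C.
Proof. by move/ger0_real/RRe_real => ->. Qed.

Lemma rnormE x : `|x| = (rnorm x)%:C%C.
Proof. exact: ger0_Re. Qed.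

Lemma Re_norm_ge0 (a : R[i]) : 0 <= complex.Re `|a|.
Proof. by have := normr_ge0 a; rewrite {1}(ger0_Re (normr_ge0 a)) lecR. Qed.

Lemma rnorm_ge0 x : 0 <= rnorm x.
Proof. by have := normr_ge0 x; rewrite rnormE lecR. Qed.

Lemma rnormD x y : rnorm (x + y) <= rnorm x + rnorm y.
Proof. by have := ler_normD x y; rewrite !rnormE -rmorphD lecR. Qed.

Lemma rnormZ (a : R[i]) x : rnorm (a *: x) = complex.Re `|a| * rnorm x.
Proof.
have /eqP := normrZ a x; rewrite !rnormE {1}(ger0_Re (normr_ge0 a)) -rmorphM.
by move/eqP/complexI.
Qed.

Lemma rnormN x : rnorm (- x) = rnorm x.
Proof. by rewrite /rnorm normrN. Qed.

Lemma rnorm0 : rnorm (0 : X) = 0.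
Proof. by rewrite /rnorm normr0. Qed.

Lemma rnorm_eq0 x : rnorm x = 0 -> x = 0.
Proof. by move=> h; apply/normr0_eq0; rewrite rnormE h. Qed.

Lemma closureP (A : set X) x :
  closure A x <-> forall e : R, 0 < e -> exists2 y, A y & rnorm (x - y) < e.
Proof.
split=> [cA e e0|H B /nbhs_ballP[e /= e0 xeB]].
  have [] := cA (ball x e%:C%C); first by apply: nbhsx_ballx; rewrite ltcR.
  by move=> y [Ay]; rewrite -ball_normE /= rnormE ltcR; exists y.
have eE : e = (complex.Re e)%:C%C.
  by apply: ger0_Re; apply: ltW.
have [|y Ay xy] := H (complex.Re e); first by rewrite -ltcR -eE.
by exists y; split=> //; apply: xeB; rewrite -ball_normE /= rnormE eE ltcR.
Qed.

Lemma closedP (A : set X) :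
  (forall x, (forall e : R, 0 < e -> exists2 y, A y & rnorm (x - y) < e) -> A x)
  <-> closed A.
Proof.
by split=> [h x /closureP|h x /closureP]; [exact: h|exact: (h x)].
Qed.

End Basics.

(** * Bounded operators and Fitting's decomposition *)
Section Operators.
Context {R : realType} {X : completeNormedModType R[i]}.
Implicit Types (x y z : X) (N M : set X) (B S F G : X -> X).

Definition bop B : Prop :=
  (forall (a : R[i]) x y, B (a *: x + y) = a *: B x + B y) /\
  exists2 C : R, 0 <= C & forall x, rnorm (B x) <= C * rnorm x.

Definition commut B G : Prop := forall x, B (G x) = G (B x).

Lemma commut_sym B G : commut B G -> commut G B.
Proof. by move=> h x. Qed.

Lemma bopD B x y : bop B -> B (x + y) = B x + B y.
Proof. by case=> h _; have := h 1 x y; rewrite !scale1r. Qed.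

Lemma bop0 B : bop B -> B 0 = 0.
Proof. by move=> h; apply: (addrI (B 0)); rewrite -bopD // !addr0. Qed.

Lemma bopZ B (a : R[i]) x : bop B -> B (a *: x) = a *: B x.
Proof. by move=> h; have := h.1 a x 0; rewrite !addr0 bop0 // addr0. Qed.

Lemma bopN B x : bop B -> B (- x) = - B x.
Proof. by move=> h; rewrite -scaleN1r bopZ // scaleN1r. Qed.

Lemma bopB B x y : bop B -> B (x - y) = B x - B y.
Proof. by move=> h; rewrite bopD // bopN. Qed.

Lemma bop_sum B (n : nat) (f : 'I_n -> X) :
  bop B -> B (\sum_(i < n) f i) = \sum_(i < n) B (f i).
Proof.
move=> h; elim/big_rec2 : _ => [|i a b _ IH]; first exact: bop0.
by rewrite bopD // IH.
Qed.

Lemma bop_lincomb B (n : nat) (c : 'I_n -> R[i]) (e : 'I_n -> X) :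
  bop B -> B (\sum_(i < n) c i *: e i) = \sum_(i < n) c i *: B (e i).
Proof.
by move=> h; rewrite bop_sum //; apply: eq_bigr => i _; rewrite bopZ.
Qed.

Lemma bop_id : bop (fun x => x).
Proof. by split=> //; exists 1 => [|x]; rewrite ?mul1r. Qed.

Lemma bop_comp B G : bop B -> bop G -> bop (fun x => B (G x)).
Proof.
move=> [hB [C C0 hC]] [hG [D D0 hD]]; split=> [a x y|]; first by rewrite hG hB.
exists (C * D); first exact: mulr_ge0.
by move=> x; apply: (le_trans (hC _)); rewrite -mulrA ler_wpM2l.
Qed.

Lemma bop_iter B n : bop B -> bop (iter n B).
Proof.
move=> h; elim: n => [|n IH]; first exact: bop_id.
exact: (bop_comp h IH).
Qed.

Lemma bop_add B G : bop B -> bop G -> bop (fun x => B x + G x).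
Proof.
move=> [hB [C C0 hC]] [hG [D D0 hD]]; split=> [a x y|].
  by rewrite hB hG scalerDr addrACA.
exists (C + D); first exact: addr_ge0.
by move=> x; apply: (le_trans (rnormD _ _)); rewrite mulrDl lerD.
Qed.

Lemma bop_scale (a : R[i]) B : bop B -> bop (fun x => a *: B x).
Proof.
move=> [hB [C C0 hC]]; split=> [b x y|].
  by rewrite hB scalerDr !scalerA mulrC.
exists (complex.Re `|a| * C); first exact: mulr_ge0 (Re_norm_ge0 a) C0.
by move=> x; rewrite rnormZ -mulrA ler_wpM2l ?Re_norm_ge0.
Qed.

Lemma bop_opp B : bop B -> bop (fun x => - B x).
Proof.
move=> /(bop_scale (-1)); rewrite (_ : (fun x => -1 *: B x) = fun x => - B x) //.
by apply/funext => x; rewrite scaleN1r.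
Qed.

Lemma bop_sub B G : bop B -> bop G -> bop (fun x => B x - G x).
Proof. by move=> hB hG; exact: (bop_add hB (bop_opp hG)). Qed.

Lemma commut_iter B G n : commut G B -> commut G (iter n B).
Proof. by move=> h; elim: n => [|n IH] x //=; rewrite h IH. Qed.

(** If [a] is the matrix of [B] in a finite family of vectors, [phi] forming the
    combinations of that family, then a polynomial in [a] is the matrix of the
    same polynomial in [B]. The operator is built by recursion on the polynomial
    and is described only by the properties that are needed later. *)
Lemma poly_intertwine n (a : 'M[R[i]]_n.+1) (phi : 'cV[R[i]]_n.+1 -> X) B
    (p : {poly R[i]}) :
  bop B -> (forall (c : R[i]) v w, phi (c *: v + w) = c *: phi v + phi w) ->
  (forall v, B (phi v) = phi (a *m v)) ->
  exists Q : X -> X, [/\ bop Q,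
    forall G, bop G -> commut G B -> commut G Q &
    forall v, Q (phi v) = phi (horner_mx a p *m v)].
Proof.
move=> hB lphi hphi; elim/poly_ind: p => [|p c [Q [hQ Qc Qphi]]].
  exists (fun x => 0 *: x); split=> [|G hG _ x|v].
  - exact: bop_scale bop_id.
  - by rewrite !scale0r bop0.
  - rewrite rmorph0 mul0mx scale0r.
    by have := lphi (-1) 0 0; rewrite scaler0 addr0 scaleN1r addNr => ->.
exists (fun x => c *: x + Q (B x)); split=> [|G hG cG x|v].
- exact: bop_add (bop_scale c bop_id) (bop_comp hQ hB).
- by rewrite bopD // bopZ // Qc // cG.
- rewrite hphi Qphi -lphi; congr phi.
  rewrite rmorphD rmorphM /= horner_mx_X horner_mx_C mulmxDl addrC.
  by rewrite mul_scalar_mx -mulmxA.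
Qed.

(** Write [p = 'X^d * q] with [q.[0] != 0]; dividing by the constant term, [q] becomes
    [1 - 'X * r]. *)
Lemma dvdp_Xn_sub (K : fieldType) (p : {poly K}) : p != 0 ->
  exists (d : nat) (r : {poly K}), p %| 'X^d - 'X^(d.+1) * r.
Proof.
move=> p0; have [d [q]] := multiplicity_XsubC p 0.
rewrite p0 /= subr0 => q0 pE.
have : root (q - q.[0]%:P) 0 by rewrite rootE !hornerE subrr.
move/factor_theorem => [s sE].
exists d, (- q.[0]^-1 *: s).
have -> : 'X^d - 'X^(d.+1) * (- q.[0]^-1 *: s) = q.[0]^-1 *: p.
  have sX : s * 'X = q - q.[0]%:P. by rewrite sE subr0.
  have qV : (q.[0]^-1)%:P * q.[0]%:P = 1 :> {poly K} by rewrite -polyCM mulVf.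
  rewrite pE -!mul_polyC exprS polyCN -[X in X - _ = _]mul1r -qV.
  move/eqP: sX; rewrite eq_sym subr_eq => /eqP; move: (_^-1)%:P (q.[0]%:P).
  by move=> u v ->; ring.
by rewrite dvdpZr // invr_eq0.
Qed.

(** Fitting's decomposition of [B] on an invariant finite dimensional subspace,
    in equational form: [Q] inverts [B] on the range of [B^d]. By
    Cayley-Hamilton [B] is annihilated there by a polynomial, of the form
    ['X^d * (1 - 'X * r)] up to a constant, and [Q] is [r] evaluated at [B]. *)
Lemma fitting (E : set X) B : bop B -> finite_dimensional E ->
  (forall x, E x -> E (B x)) ->
  exists (d : nat) (Q : X -> X), [/\ bop Q,
    forall G, bop G -> commut G B -> commut G Q &
    forall x, E x -> iter d B x = B (Q (iter d B x))].
Proof.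
move=> hB [[|n] [e [eE spanE]]] BE.
  exists 0%N, (fun x => x); split=> [|//|x Ex]; first exact: bop_id.
  have E0 y : E y -> y = 0 by case/spanE=> c ->; rewrite big_ord0.
  by rewrite /= (E0 _ Ex) bop0.
have /choice[c cE] i := spanE _ (BE _ (eE i)).
pose a : 'M[R[i]]_n.+1 := \matrix_(j, i) c i j.
pose phi (v : 'cV[R[i]]_n.+1) := \sum_i v i 0 *: e i.
have lphi k v w : phi (k *: v + w) = k *: phi v + phi w.
  rewrite /phi scaler_sumr -big_split /=; apply: eq_bigr => i _.
  by rewrite !mxE scalerDl scalerA.
have Bphi v : B (phi v) = phi (a *m v).
  rewrite /phi bop_lincomb //; under eq_bigr do rewrite cE scaler_sumr.
  rewrite exchange_big; apply: eq_bigr => j _; rewrite !mxE scaler_suml.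
  by apply: eq_bigr => i _; rewrite !mxE scalerA mulrC.
have [d [r /dvdpP[s sE]]] := dvdp_Xn_sub (monic_neq0 (char_poly_monic a)).
have [Q [hQ Qc Qphi]] := poly_intertwine r hB lphi Bphi.
exists d, Q; split=> // x /spanE[k kE].
have -> : x = phi (\col_i k i).
  by rewrite kE; apply: eq_bigr => i _; rewrite mxE.
have iterphi m v : iter m B (phi v) = phi (a ^+ m *m v).
  elim: m => [|m IH] /=; first by rewrite expr0 mul1mx.
  by rewrite IH Bphi exprS -mulmxE mulmxA.
rewrite iterphi Qphi Bphi; congr phi; rewrite !mulmxA; congr (_ *m _).
have : horner_mx a ('X^d - 'X * r * 'X^d) = 0.
  rewrite -[RHS](mulr0 (horner_mx a s)) -(Cayley_Hamilton a) -rmorphM -sE.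
  by congr horner_mx; rewrite exprS; ring.
by move/eqP; rewrite rmorphB !rmorphM rmorphXn /= horner_mx_X subr_eq0 => /eqP.
Qed.

End Operators.

(** * The analytical core and the quasinilpotent part *)
Section CoreAndQuasinilpotentPart.
Context {R : realType} {X : completeNormedModType R[i]}.
Implicit Types (x y z : X) (N M : set X) (B S F G : X -> X).

(** [submod_closed] without the boolean membership of [mem N]. *)
Definition subsp N : Prop :=
  N 0 /\ forall (a : R[i]) x y, N x -> N y -> N (a *: x + y).

Lemma subspD N x y : subsp N -> N x -> N y -> N (x + y).
Proof. by move=> [_ h] Nx Ny; have := h 1 _ _ Nx Ny; rewrite scale1r. Qed.

Lemma subspZ N a x : subsp N -> N x -> N (a *: x).
Proof. by move=> [N0 h] Nx; have := h a _ _ Nx N0; rewrite addr0. Qed.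

Lemma subspN N x : subsp N -> N x -> N (- x).
Proof. by move=> h Nx; rewrite -scaleN1r; exact: subspZ. Qed.

Lemma subspB N x y : subsp N -> N x -> N y -> N (x - y).
Proof. by move=> h Nx Ny; apply: subspD => //; exact: subspN. Qed.

Lemma subsp_sum N (n : nat) (f : 'I_n -> X) :
  subsp N -> (forall i, N (f i)) -> N (\sum_(i < n) f i).
Proof.
move=> hN Nf; elim/big_ind : _ => [|x y|i _]; [exact: hN.1|exact: subspD|exact: Nf].
Qed.

Lemma subsp_closed_subspace N : closed_subspace N <-> subsp N /\ closed N.
Proof.
rewrite /closed_subspace; split=> [[[N0 lN] cN]|[[N0 lN] cN]]; split=> //; split.
- by move: N0; rewrite inE.
- by move=> a x y Nx Ny; have := lN a x y; rewrite !inE; apply.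
- by rewrite inE.
- by move=> a x y; rewrite !inE; exact: lN.
Qed.

(** The analytical core with the bound on the orbit freed from the norm of its
    starting point: in this form closure under sums and under commuting operators
    is immediate. *)
Definition geometric_core S : set X :=
  [set x | exists (u : nat -> X) (C d : R),
    [/\ u 0%N = x, forall n, S (u n.+1) = u n, 0 <= C, 0 <= d &
        forall n, rnorm (u n) <= C * d ^+ n]].

Lemma analytical_coreE S : bop S -> analytical_core S = geometric_core S.
Proof.
move=> hS; apply/seteqP; split=> x.
  move=> [u [d [d0 Sx Su nu]]].
  exists (fun n => if n is m.+1 then u m.+1 else x), (rnorm x), d.
  split=> //; [by case=> [|n] //; rewrite Su|exact: rnorm_ge0|exact: ltW|].
  by case=> [|n]; [rewrite expr0 mulr1|rewrite mulrC nu].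
move=> [u [C [d [<- Su C0 d0 nu]]]].
have [u0|un0] := eqVneq (u 0%N) 0.
  exists (fun _ => 0), 1; split=> //.
  - by rewrite u0 bop0.
  - by move=> *; rewrite bop0.
  - by move=> n _; rewrite u0 !rnorm0 mulr0.
have nx : 0 < rnorm (u 0%N).
  rewrite lt_neqAle rnorm_ge0 andbT eq_sym.
  by apply: contra un0 => /eqP/rnorm_eq0/eqP.
(* As [n >= 1], the factor [k ^+ n >= k] absorbs the constant [C] into the ratio. *)
pose k := 1 + C / rnorm (u 0%N).
have q0 : 0 <= C / rnorm (u 0%N) by rewrite divr_ge0 // ltW.
have k1 : 1 <= k by rewrite lerDl.
have d1 : 0 < d + 1 by rewrite ltr_wpDl.
exists u, (k * (d + 1)); split=> // [|n n0].
  by rewrite mulr_gt0 // (lt_le_trans ltr01 k1).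
apply: (le_trans (nu n)).
apply: (@le_trans _ _ (k * rnorm (u 0%N) * (d + 1) ^+ n)).
  apply: ler_pM => //; first exact: exprn_ge0.
    by rewrite mulrDl mul1r divfK ?gt_eqF // lerDr rnorm_ge0.
  by apply: lerXn2r; rewrite ?nnegrE ?(ltW d1) // lerDl.
rewrite exprMn mulrAC ler_wpM2r ?rnorm_ge0 // ler_wpM2r ?exprn_ge0 ?addr_ge0 //.
by rewrite -[leLHS]expr1 ler_weXn2l.
Qed.

Lemma geometric_core_subsp S : bop S -> subsp (geometric_core S).
Proof.
move=> hS; split.
  exists (fun _ => 0), 0, 0; split=> // [|n]; first by move=> _; exact: bop0.
  by rewrite rnorm0 mul0r.
move=> a _ _ [u [C [d [<- Su C0 d0 nu]]]] [v [D [e [<- Sv D0 e0 nv]]]].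
have a0 := Re_norm_ge0 a.
exists (fun n => a *: u n + v n), (complex.Re `|a| * C + D), (d + e); split=> //.
- by move=> n; rewrite bopD // bopZ // Su Sv.
- by rewrite addr_ge0 // mulr_ge0.
- exact: addr_ge0.
move=> n; apply: (le_trans (rnormD _ _)); rewrite rnormZ mulrDl -mulrA.
apply: lerD; first apply: ler_wpM2l => //.
  apply: (le_trans (nu n)); apply: ler_wpM2l => //.
  by apply: lerXn2r; rewrite ?nnegrE ?addr_ge0 // lerDl.
apply: (le_trans (nv n)); apply: ler_wpM2l => //.
by apply: lerXn2r; rewrite ?nnegrE ?addr_ge0 // lerDr.
Qed.

Lemma geometric_core_commut S G x : bop G -> commut G S ->
  geometric_core S x -> geometric_core S (G x).
Proof.
move=> [_ [M M0 hM]] GS [u [C [d [<- Su C0 d0 nu]]]].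
exists (fun n => G (u n)), (M * C), d; split=> //.
- by move=> n; rewrite -GS Su.
- exact: mulr_ge0.
- by move=> n; apply: (le_trans (hM _)); rewrite -mulrA ler_wpM2l.
Qed.

Lemma geometric_core_lift S n x : geometric_core S x ->
  exists2 y, geometric_core S y & iter n S y = x.
Proof.
move=> [u [C [d [<- Su C0 d0 nu]]]]; exists (u n).
  exists (fun m => u (n + m)%N), (C * d ^+ n), d; split=> //.
  - by rewrite addn0.
  - by move=> m; rewrite addnS.
  - by rewrite mulr_ge0 // exprn_ge0.
  - by move=> m; rewrite -mulrA -exprD.
by elim: n => // n IH; rewrite iterSr Su.
Qed.

(** The quasinilpotent part without roots: up to a constant, the orbit is bounded
    by every geometric sequence of positive ratio. *)
Definition qnil S : set X :=
  [set x | forall e : R, 0 < e -> exists2 C : R, 0 <= C &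
    forall n, rnorm (iter n S x) <= C * e ^+ n].

Lemma qnil_subsp S : bop S -> subsp (qnil S).
Proof.
move=> hS; split.
  move=> e e0; exists 0 => // n.
  by rewrite (bop0 (bop_iter n hS)) rnorm0 mul0r.
move=> a x y hx hy e e0; have [C C0 hC] := hx e e0; have [D D0 hD] := hy e e0.
have a0 := Re_norm_ge0 a.
exists (complex.Re `|a| * C + D); first by rewrite addr_ge0 // mulr_ge0.
move=> n; rewrite (bopD _ _ (bop_iter n hS)) (bopZ _ _ (bop_iter n hS)).
apply: (le_trans (rnormD _ _)); rewrite rnormZ mulrDl -mulrA.
by apply: lerD => //; apply: ler_wpM2l.
Qed.

Lemma qnil_commut S G x : bop G -> commut G S -> qnil S x -> qnil S (G x).
Proof.
move=> [_ [M M0 hM]] GS hx e e0; have [C C0 hC] := hx e e0.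
exists (M * C) => [|n]; first exact: mulr_ge0.
rewrite -(commut_iter n GS); apply: (le_trans (hM _)).
by rewrite -mulrA ler_wpM2l.
Qed.

Lemma qnil_preimage S x : qnil S (S x) -> qnil S x.
Proof.
move=> hx e e0; have [C C0 hC] := hx e e0.
exists (rnorm x + C / e); first by rewrite addr_ge0 ?rnorm_ge0 ?divr_ge0 // ltW.
case=> [|n]; first by rewrite expr0 mulr1 lerDl divr_ge0 // ltW.
rewrite iterSr; apply: (le_trans (hC n)).
rewrite mulrDl exprS [C / e * _]mulrA divfK ?gt_eqF // lerDr.
by rewrite mulr_ge0 ?rnorm_ge0 // mulr_ge0 ?exprn_ge0 // ltW.
Qed.

End CoreAndQuasinilpotentPart.

(** * Closed sets *)
Section Topology.
Context {R : realType} {X : completeNormedModType R[i]}.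
Implicit Types (x y z : X) (N M : set X) (B S F G : X -> X).

Lemma quasinilpotent_partE S : quasinilpotent_part S = qnil S.
Proof.
apply/seteqP; split=> x.
  move=> /cvgrPdist_lt cv e e0.
  have [N _ hN] := cv e e0.
  exists (1 + \sum_(k < N.+1) rnorm (iter k S x) / e ^+ k).
    rewrite addr_ge0 // sumr_ge0 // => k _.
    by rewrite divr_ge0 ?rnorm_ge0 // exprn_ge0 // ltW.
  move=> n; have en0 : 0 < e ^+ n by exact: exprn_gt0.
  have [nN|nN] := ltnP n N.+1.
    rewrite -ler_pdivrMr // (bigD1 (Ordinal nN)) //= addrCA lerDl.
    rewrite addr_ge0 // sumr_ge0 // => k _.
    by rewrite divr_ge0 ?rnorm_ge0 // exprn_ge0 // ltW.
  have n0 : (0 < n)%N by exact: leq_ltn_trans nN.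
  have := hN n (ltnW nN); rewrite /= sub0r normrN ger0_norm ?powR_ge0 // => h.
  apply: (@le_trans _ _ (e ^+ n)).
    rewrite -[leLHS]powRr1 ?rnorm_ge0 // -(@mulVf _ n%:R) ?pnatr_eq0 -?lt0n //.
    rewrite powRrM powR_mulrn ?powR_ge0 //.
    by apply: lerXn2r; rewrite ?nnegrE ?powR_ge0 ?ltW.
  rewrite -[leLHS]mul1r ler_pM2r // lerDl sumr_ge0 // => k _.
  by rewrite divr_ge0 ?rnorm_ge0 // exprn_ge0 // ltW.
(* The bound for [e / 2] leaves a factor [2 ^- n] which beats the constant. *)
move=> hx; apply/cvgrPdist_lt => e e0.
have e2 : 0 < e / 2 by rewrite divr_gt0.
have [C C0 hC] := hx _ e2.
exists (Num.bound C).+1 => // n /= nC.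
rewrite sub0r normrN ger0_norm ?powR_ge0 //.
have n0 : (0 < n)%N by exact: leq_ltn_trans nC.
have : rnorm (iter n S x) < e ^+ n.
  apply: (le_lt_trans (hC n)); rewrite expr_div_n mulrCA gtr_pMr ?exprn_gt0 //.
  by rewrite ltr_pdivrMr ?exprn_gt0 // mul1r upper_nthrootP // ltnW.
have n0' : 0 < n%:R^-1 :> R by rewrite invr_gt0 ltr0n.
move/(gt0_ltr_powR n0'); rewrite !nnegrE rnorm_ge0 exprn_ge0 1?ltW // => /(_ isT isT).
rewrite -[X in _ < X `^ _](powR_mulrn _ (ltW e0)) -powRrM mulfV ?powRr1 ?ltW //.
by rewrite pnatr_eq0 -lt0n.
Qed.

Lemma closed_bop_preimage G (A : set X) :
  bop G -> closed A -> closed [set x | A (G x)].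
Proof.
move=> hG /closedP cA; apply/closedP => x hx; apply: cA => e e0.
have [_ [C C0 hC]] := hG.
have C1 : 0 < C + 1 by rewrite ltr_wpDl.
have [y Ay xy] := hx (e / (C + 1)) (divr_gt0 e0 C1).
exists (G y) => //; rewrite -bopB //; apply: (le_lt_trans (hC _)).
apply: (@le_lt_trans _ _ ((C + 1) * rnorm (x - y))).
  by rewrite ler_wpM2r ?rnorm_ge0 // lerDl.
by rewrite mulrC -ltr_pdivlMr.
Qed.

Lemma closed_bop_ker G : bop G -> closed [set x | G x = 0].
Proof.
move=> hG; apply: (@closed_bop_preimage G [set 0]) => //.
apply/closedP => x hx; apply: rnorm_eq0; apply/eqP; rewrite eq_le rnorm_ge0.
rewrite andbT; apply/ler_addgt0Pr => e e0.
by rewrite add0r; have [y -> ] := hx e e0; rewrite subr0 => /ltW.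
Qed.

(** Each [a k - r k] is below each [a l + r l], so any number between the two
    families, such as the supremum of the first one, works. *)
Lemma real_cauchy_limit (a r : nat -> R) :
  (forall k l, a k - a l <= r k + r l) ->
  exists b, forall k, `|a k - b| <= r k.
Proof.
move=> h; pose A := [set a k - r k | k in [set: nat]].
have ubA l : ubound A (a l + r l).
  by move=> _ [k _ <-]; have := h k l; lra.
have A0 : A !=set0 by exists (a 0%N - r 0%N), 0%N.
have supA : has_ubound A by exists (a 0%N + r 0%N).
exists (sup A) => k; rewrite ler_distlC.
rewrite (ge_sup A0 (ubA k)) andbT; apply: ub_le_sup => //.
by exists k.
Qed.

Lemma complex_norm_le (w : R[i]) :
  [/\ `|complex.Re w| <= complex.Re `|w|, `|complex.Im w| <= complex.Re `|w| &
      complex.Re `|w| <= `|complex.Re w| + `|complex.Im w|].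
Proof.
have Re_le (v : R[i]) : `|complex.Re v| <= complex.Re `|v|.
  by have := normc_ge_Re v; rewrite {2}(ger0_Re (normr_ge0 v)) lecR.
have ni : `|'i%C| = 1 :> R[i] by exact: normCi.
split=> //.
  by have := Re_le (w * 'i%C); rewrite ReiNIm normrN normrM ni mulr1.
have := ler_normD (complex.Re w)%:C%C ('i%C * (complex.Im w)%:C%C).
rewrite -complexE normrM ni mul1r !normc_def /= !expr0n !addr0 !sqrtr_sqr.
by rewrite -rmorphD lecR.
Qed.

Lemma complex_cauchy_limit (c : nat -> R[i]) (r : nat -> R) :
  (forall k l, complex.Re `|c k - c l| <= r k + r l) ->
  exists b, forall k, complex.Re `|c k - b| <= r k + r k.
Proof.
move=> h.
have [a ha] : exists a, forall k, `|complex.Re (c k) - a| <= r k.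
  apply: real_cauchy_limit => k l; apply: (le_trans _ (h k l)).
  have [H _ _] := complex_norm_le (c k - c l).
  by apply: (le_trans (ler_norm _)); move: H; rewrite raddfB.
have [b hb] : exists b, forall k, `|complex.Im (c k) - b| <= r k.
  apply: real_cauchy_limit => k l; apply: (le_trans _ (h k l)).
  have [_ H _] := complex_norm_le (c k - c l).
  by apply: (le_trans (ler_norm _)); move: H; rewrite raddfB.
exists (a +i* b)%C => k; have [_ _] := complex_norm_le (c k - (a +i* b)%C).
by move/le_trans; apply; rewrite !raddfB /=; apply: lerD.
Qed.

Definition add_line N z : set X := [set x | exists (c : R[i]) n, N n /\ x = c *: z + n].

(** When [z] is outside [N], the distance [e] from [z] to [N] is positive and
    controls the coefficient of [z] by the norm of the whole vector. So the
    coefficients of a sequence approaching a limit point are Cauchy; subtracting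
    the limiting multiple of [z] leaves a limit point of [N]. *)
Lemma add_line_closed N z : subsp N -> closed N -> closed (add_line N z).
Proof.
move=> sN cN.
have [Nz|Nz] := pselect (N z).
  suff -> : add_line N z = N by [].
  apply/seteqP; split=> [_ [c [n [Nn ->]]]|x Nx]; first exact: sN.2.
  by exists 0, x; rewrite scale0r add0r.
have [e e0 he] : exists2 e : R, 0 < e & forall n, N n -> e <= rnorm (z - n).
  apply: contrapT => H; apply: Nz; move/closedP: cN; apply => e e0.
  apply: contrapT => H'; apply: H; exists e => // n Nn.
  by rewrite leNgt; apply/negP => zn; apply: H'; exists n.
have coef c n : N n -> complex.Re `|c| <= rnorm (c *: z + n) / e.
  move=> Nn; rewrite ler_pdivlMr //.
  have [->|c0] := eqVneq c 0; first by rewrite normr0 mul0r rnorm_ge0.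
  have -> : c *: z + n = c *: (z - (- c^-1 *: n)).
    by rewrite scalerBr scalerA mulrN mulfV // scaleN1r opprK.
  rewrite rnormZ ler_wpM2l ?Re_norm_ge0 //; apply: he; exact: subspZ.
apply/closedP => x hx.
have rpos k : 0 < k.+1%:R^-1 :> R by rewrite invr_gt0 ltr0n.
have /choice[c hc] k : exists c, exists2 n, N n & rnorm (x - (c *: z + n)) < k.+1%:R^-1.
  by have [_ [c [n [Nn ->]]] xn] := hx _ (rpos k); exists c, n.
pose r k : R := k.+1%:R^-1 / e.
have [b hb] : exists b, forall k, complex.Re `|c k - b| <= r k + r k.
  apply: complex_cauchy_limit => k l.
  have [n Nn xn] := hc k; have [m Nm xm] := hc l.
  apply: (le_trans (coef _ _ (subspB sN Nn Nm))).
  rewrite /r -mulrDl ler_wpM2r ?invr_ge0 ?(ltW e0) //.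
  have -> : (c k - c l) *: z + (n - m) = (x - (c l *: z + m)) - (x - (c k *: z + n)).
    by rewrite opprB [RHS]addrC [RHS]addrA subrK scalerBl opprD addrACA.
  apply: (le_trans (rnormD _ _)); by rewrite rnormN addrC lerD // ltW.
exists b, (x - b *: z); split; last by rewrite addrC subrK.
move/closedP: cN; apply => d d0.
pose L := 1 + (1 / e + 1 / e) * rnorm z.
have L0 : 0 < L.
  by rewrite ltr_pwDl // mulr_ge0 ?rnorm_ge0 // addr_ge0 // divr_ge0 // ltW.
have [k _ /(_ k (leqnn k)) hk] := @nbhs_infty_gtr R (L / d).
have [n Nn xn] := hc k; exists n => //.
have -> : x - b *: z - n = (x - (c k *: z + n)) + (c k - b) *: z.
  by rewrite scalerBl opprD [- _ - n]addrC [RHS]addrA [x + (_ + _)]addrA subrK addrAC.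
apply: (@le_lt_trans _ _ (k.+1%:R^-1 * L)).
  apply: (le_trans (rnormD _ _)); rewrite mulrDr mulr1 lerD ?(ltW xn) // rnormZ.
  rewrite mulrA ler_wpM2r ?rnorm_ge0 //; apply: (le_trans (hb k)).
  by rewrite /r mulrDr !mul1r.
rewrite mulrC ltr_pdivrMr ?ltr0n // mulrC -ltr_pdivrMr //.
by apply: (lt_trans hk); rewrite ltr_nat.
Qed.

End Topology.

(** * Commuting finite rank operators and extension of complements *)
Section Algebra.
Context {R : realType} {X : completeNormedModType R[i]}.
Implicit Types (x y z : X) (M N : set X) (A B S F G Q : X -> X).

(** In the next lemmas [A (Q x) = x] with [A] and [Q] commuting says that [x] lies
    where [Q] inverts [A], so [Q] supplies a backward orbit of [x]. *)
Lemma iter_fixed A Q w : commut A Q -> A (Q w) = w ->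
  forall n, iter n A (iter n Q w) = w.
Proof.
move=> AQ AQw; elim=> [//|n IH].
by rewrite iterSr (commut_iter n.+1 AQ) iterSr -AQ AQw.
Qed.

Lemma bop_iter_bound G : bop G ->
  exists2 g : R, 0 <= g & forall n x, rnorm (iter n G x) <= g ^+ n * rnorm x.
Proof.
move=> [_ [g g0 hg]]; exists g => // n x; elim: n => [|n IH].
  by rewrite expr0 mul1r.
by apply: (le_trans (hg _)); rewrite exprS -mulrA ler_wpM2l.
Qed.

Lemma geometric_core_fixed A Q x : bop Q -> commut A Q -> A (Q x) = x ->
  geometric_core A x.
Proof.
move=> hQ AQ AQx; have [g g0 hg] := bop_iter_bound hQ.
exists (fun n => iter n Q x), (rnorm x), g; split=> //.
- by move=> n; rewrite (commut_iter n.+1 AQ) iterSr -AQ AQx.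
- exact: rnorm_ge0.
- by move=> n; rewrite mulrC.
Qed.

(** The backward orbit grows at most geometrically, while quasinilpotence makes
    the forward orbit decay faster than any geometric sequence. *)
Lemma qnil_fixed A Q x : bop Q -> commut A Q -> A (Q x) = x ->
  qnil A x -> x = 0.
Proof.
move=> hQ AQ AQx Ax; have [g g0 hg] := bop_iter_bound hQ.
have g1 : 0 < g + 1 by rewrite ltr_wpDl.
have [|C C0 hC] := Ax (2 * (g + 1))^-1; first by rewrite invr_gt0 mulr_gt0.
have bound n : rnorm x * 2 ^+ n <= C.
  rewrite -[x in rnorm x](iter_fixed AQ AQx n).
  rewrite (commut_iter n (commut_sym (commut_iter n (commut_sym AQ)))).
  rewrite -ler_pdivlMr ?exprn_gt0 //; apply: (le_trans (hg _ _)).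
  apply: (@le_trans _ _ ((g + 1) ^+ n * (C * (2 * (g + 1))^-1 ^+ n))).
    apply: ler_pM => //; rewrite ?exprn_ge0 ?rnorm_ge0 //.
    by apply: lerXn2r; rewrite ?nnegrE ?(ltW g1) // lerDl.
  rewrite exprVn exprMn invfM mulrCA [_^-1 * _^-1]mulrC.
  by rewrite [X in C * X]mulrA mulfV ?mul1r // expf_neq0 // gt_eqF.
apply: rnorm_eq0; apply/eqP; rewrite eq_le rnorm_ge0 andbT leNgt.
apply/negP => x0; pose k := Num.bound (C / rnorm x).
have := bound k; rewrite -ler_pdivlMl // mulrC leNgt => /negP; apply.
exact: upper_nthrootP.
Qed.

(** By [fitting], [S] is invertible on the vectors [iter d S x]; such a vector is
    zero when it is also quasinilpotent. *)
Lemma qnil_finite_dimensional (E : set X) S : bop S -> finite_dimensional E ->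
  (forall x, E x -> E (S x)) ->
  exists d, forall x, E x -> qnil S x -> iter d S x = 0.
Proof.
move=> hS fE SE; have [d [Q [hQ Qc dE]]] := fitting hS fE SE.
have SQ : commut S Q by apply: Qc => // x.
exists d => x Ex qx; apply: (qnil_fixed hQ SQ); first by rewrite -dE.
by apply: qnil_commut => //; [exact: bop_iter|exact/commut_sym/commut_iter].
Qed.

(** The Fitting projection of [F]. With [r] inverting [F] on the range of [F^p],
    it is [r^p F^p]; the extra factor in [p = d.+1] brings all of [X] into the
    range of [F], where [fitting] applies. *)
Lemma finite_rank_projection F : bop F -> finite_dimensional (range F) ->
  exists p Q, [/\ bop Q, forall G, bop G -> commut G F -> commut G Q,
    forall x, range F (Q x), forall x, F x = 0 -> Q x = 0 &
    forall x, iter p F (x - Q x) = 0 /\ Q (Q x) = Q x].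
Proof.
move=> hF fF; have [|d [r [hr rc dE]]] := fitting hF fF.
  by move=> _ [x _ <-]; exists (F x).
have Fr : commut F r by apply: rc => // x.
pose p := d.+1; pose Q x := iter p r (iter p F x).
have pE x : iter p F (Q x) = iter p F x.
  apply: iter_fixed => //; rewrite /p iterSr; apply/esym/dE; by exists x.
have hQ : bop Q by apply: bop_comp; exact: bop_iter.
exists p, Q; split=> // [G hG GF x|x|x Fx|x].
- by rewrite /Q (commut_iter p (rc _ hG GF)) (commut_iter p GF).
- exists (iter p r (iter d F x)) => //.
  by rewrite (commut_iter p Fr) -iterS.
- rewrite /Q /p [iter _ F x]iterSr Fx (bop0 (bop_iter d hF)).
  exact: bop0 (bop_iter _ hr).
- split; first by rewrite (bopB _ _ (bop_iter p hF)) pE subrr.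
  by rewrite {1}/Q pE.
Qed.

(** The factorization of [(A + F)^p - F^p] by [A]. The quotient is a polynomial in
    [A] and [F], hence the commutation clause. *)
Lemma iter_add_factor A F p : bop A -> bop F -> commut A F ->
  exists G, [/\ bop G,
    forall H, bop H -> commut H A -> commut H F -> commut H G &
    forall x, iter p (fun x => A x + F x) x = A (G x) + iter p F x].
Proof.
move=> hA hF AF; elim: p => [|p [G [hG Gc pE]]].
  exists (fun=> 0); split=> [|H hH _ _ x|x].
  - rewrite (_ : (fun=> 0) = fun x : X => 0 *: x); last first.
      by apply/funext => x; rewrite scale0r.
    exact: bop_scale bop_id.
  - exact: bop0.
  - by rewrite bop0 // add0r.
exists (fun x => (A (G x) + F (G x)) + iter p F x); split=> [|H hH HA HF x|x].
- by apply: bop_add (bop_iter p hF); apply: bop_add; exact: bop_comp.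
- by rewrite !(bopD _ _ hH) HA HF Gc // (commut_iter p HF).
- rewrite iterS pE !(bopD _ _ hA) !(bopD _ _ hF) -AF -addrA -addrA.
  by rewrite -!addrA [A (iter p F x) + _]addrCA.
Qed.

Lemma iter_opp F p x : bop F -> iter p F x = 0 -> iter p (fun x => - F x) x = 0.
Proof.
move=> hF Fp; suff -> : iter p (fun x => - F x) x = (-1) ^+ p *: iter p F x.
  by rewrite Fp scaler0.
elim: p {Fp} => [|p IH]; first by rewrite expr0 scale1r.
by rewrite !iterS IH bopZ // exprS -scalerA scaleN1r.
Qed.

(** Where [F^p] vanishes, [(A + F)^p = A G]. So if [u] is a backward orbit of
    [A + F], then [G^n (u (p * n))] is one of [A], still of geometric growth. The
    projection [P] keeps the orbit inside the kernel of [F^p]. *)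
Lemma geometric_core_nilpotent A F P p y : bop A -> bop F -> commut A F ->
  bop P -> commut P A -> commut P F -> (forall x, iter p F (P x) = 0) ->
  P y = y -> geometric_core (fun x => A x + F x) y -> geometric_core A y.
Proof.
move=> hA hF AF hP PA PF FP Py [u [C [d [u0 Au C0 d0 nu]]]].
have [G [hG Gc pE]] := iter_add_factor p hA hF AF.
have PG : commut P G by exact: Gc.
have hAF := bop_add hA hF.
have GAF : commut G (fun x => A x + F x).
  have AG : commut A G by apply: Gc => // x.
  have FG : commut F G by apply: Gc => // x; rewrite AF.
  by move=> x; rewrite bopD // AG FG.
have PAF : commut P (fun x => A x + F x) by move=> x; rewrite bopD // PA PF.
have [g g0 hg] := bop_iter_bound hG; have [_ [c c0 hc]] := hP.
exists (fun n => iter n G (P (u (p * n)%N))), (c * C), (g * d ^+ p).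
split=> //.
- by rewrite muln0 /= u0.
- move=> n; have uS m k : iter m (fun x => A x + F x) (u (m + k)%N) = u k.
    by elim: m => // m IH; rewrite iterSr addSn Au.
  rewrite mulnS iterS -(commut_iter n PG).
  have AGP w : A (G (P w)) = iter p (fun x => A x + F x) (P w).
    by rewrite pE FP addr0.
  have cm (H : X -> X) : commut H (fun x => A x + F x) ->
    forall w, iter p (fun x => A x + F x) (H w) = H (iter p (fun x => A x + F x) w).
    by move=> hH w; rewrite -(commut_iter p hH).
  rewrite AGP cm // cm; last exact/commut_sym/commut_iter/commut_sym.
  by rewrite uS (commut_iter n PG).
- exact: mulr_ge0.
- by rewrite mulr_ge0 // exprn_ge0.
move=> n; apply: (le_trans (hg _ _)).
apply: (@le_trans _ _ (g ^+ n * (c * (C * d ^+ (p * n))))).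
  rewrite ler_wpM2l ?exprn_ge0 //; apply: (le_trans (hc _)).
  by rewrite ler_wpM2l.
by rewrite exprMn -exprM !mulrA [g ^+ n * c]mulrC [c * g ^+ n * C]mulrAC.
Qed.

(** The kernel of [G] in [N] has finite codimension in [N]. Each step of the
    induction either finds a vector [u0] of [N] whose image has a nonzero first
    coordinate, and uses it to clear that coordinate, or drops the coordinate. *)
Lemma finite_rank_generators n G (e : 'I_n -> X) N : bop G -> subsp N ->
  (forall x, N x -> exists c : 'I_n -> R[i], G x = \sum_i c i *: e i) ->
  exists m (u : 'I_m -> X), (forall i, N (u i)) /\
    forall x, N x -> exists c : 'I_m -> R[i], G (x - \sum_i c i *: u i) = 0.
Proof.
move=> hG; elim: n e N => [|n IH] e N sN hN.
  exists 0%N, (fun=> 0); split=> [[]//|x Nx]; exists (fun=> 0).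
  by have [c cE] := hN _ Nx; rewrite big_ord0 subr0 cE big_ord0.
pose e' i := e (lift ord0 i).
pose N' := [set x | N x /\ exists c : 'I_n -> R[i], G x = \sum_i c i *: e' i].
have [[u0 [Nu0 [c0 [c0E c00]]]]|noU] := pselect
  (exists u0, N u0 /\ exists c : 'I_n.+1 -> R[i],
     G u0 = \sum_i c i *: e i /\ c ord0 != 0); last first.
  apply: (IH e' N sN) => x Nx; have [c cE] := hN _ Nx.
  exists (fun i => c (lift ord0 i)); rewrite cE big_ord_recl.
  suff -> : c ord0 = 0 by rewrite scale0r add0r.
  by apply: contrapT => /eqP c0; apply: noU; exists x; split=> //; exists c.
have sN' : subsp N'.
  split; first by split; [exact: sN.1|exists (fun=> 0)];
    rewrite bop0 // big1 // => i _; rewrite scale0r.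
  move=> a x y [Nx [c cE]] [Ny [k kE]]; split; first exact: sN.2.
  exists (fun i => a * c i + k i); rewrite bopD // bopZ // cE kE scaler_sumr.
  by rewrite -big_split; apply: eq_bigr => i _; rewrite scalerDl scalerA.
have [|m [u [N'u hu]]] := IH e' N' sN'; first by move=> x [].
exists m.+1, (fun i => if unlift ord0 i is Some j then u j else u0).
split=> [i|x Nx]; first by case: unliftP => // j _; case: (N'u j).
have [c cE] := hN _ Nx; pose a := c ord0 / c0 ord0.
have [|k kE] := hu (x - a *: u0).
  split; first by apply: subspB => //; exact: subspZ.
  exists (fun i => c (lift ord0 i) - a * c0 (lift ord0 i)).
  rewrite bopB // bopZ // cE c0E !big_ord_recl scalerDr opprD addrACA.
  rewrite scalerA divfK // subrr add0r scaler_sumr -sumrB.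
  by apply: eq_bigr => i _; rewrite scalerBl scalerA.
exists (fun i => if unlift ord0 i is Some j then k j else a).
rewrite big_ord_recl unlift_none opprD addrA.
by under eq_bigr do rewrite liftK.
Qed.

Definition sumset M N : set X := [set x | exists m n, [/\ M m, N n & x = m + n]].

Lemma sumset_subsp M N : subsp M -> subsp N -> subsp (sumset M N).
Proof.
move=> sM sN; split.
  by exists 0, 0; split; [exact: sM.1|exact: sN.1|rewrite addr0].
move=> a _ _ [m [n [Mm Nn ->]]] [m' [n' [Mm' Nn' ->]]].
exists (a *: m + m'), (a *: n + n'); split; [exact: sM.2|exact: sN.2|].
by rewrite scalerDr addrACA.
Qed.

Lemma sumset_monotone M N N' x : N `<=` N' -> sumset M N x -> sumset M N' x.
Proof. by move=> NN' [m [n [Mm Nn ->]]]; exists m, n; split=> //; exact: NN'. Qed.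

(** The properties of a complement of [M] other than spanning [X] together with
    [M]: they survive the adjunction of one vector at a time. *)
Definition partial_complement A M N : Prop :=
  [/\ subsp N, closed N, forall x, N x -> N (A x), N `<=` qnil A &
      forall x, M x -> N x -> x = 0].

Section Extension.
Context (A : X -> X) (M : set X).
Context (hA : bop A) (sM : subsp M).
Context (AM : forall x, M x -> exists2 y, M y & A y = x).

(** Write [A z = m + n] and lift [m] to [m'] in [M]: then [z - m'] is mapped into
    [N] and can be adjoined to [N] without losing invariance. It is
    quasinilpotent because its image is. *)
Lemma partial_complement_step N z : partial_complement A M N ->
  sumset M N (A z) ->
  exists N', [/\ partial_complement A M N', N `<=` N' & sumset M N' z].
Proof.
move=> hN [m [n [Mm Nn Az]]]; have [sN cN AN qN MN] := hN.
have [zU|zU] := pselect (sumset M N z); first by exists N; split.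
have [m' Mm' Am'] := AM Mm; pose z' := z - m'.
have Az' : A z' = n by rewrite /z' bopB // Az Am' addrAC subrr add0r.
have NN' : N `<=` add_line N z'.
  by move=> x Nx; exists 0, x; rewrite scale0r add0r; split.
exists (add_line N z'); split=> //; last first.
  exists m', z'; rewrite addrC subrK; split=> //.
  by exists 1, 0; rewrite scale1r addr0; split=> //; exact: sN.1.
have sq := qnil_subsp hA.
have qz' : qnil A z' by apply: qnil_preimage; rewrite Az'; exact: qN.
split=> [|||_ [c [k [Nk ->]]]|x Mx [c [k [Nk xE]]]].
- split; first exact/NN'/sN.1.
  move=> a _ _ [c [k [Nk ->]]] [d [l [Nl ->]]].
  exists (a * c + d), (a *: k + l); split; first exact: sN.2.
  by rewrite scalerDr scalerA scalerDl addrACA.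
- exact: add_line_closed.
- move=> _ [c [k [Nk ->]]]; apply: NN'; rewrite bopD // bopZ // Az'.
  by apply: sN.2 => //; exact: AN.
- by apply: sq.2 => //; exact: qN.
- move: Mx; rewrite xE; have [->|c0] := eqVneq c 0.
    by rewrite scale0r add0r => Mk; exact: MN.
  (* A nonzero coefficient would express [z] by [M] and [N]. *)
  move=> Mx; exfalso; apply: zU; exists (c^-1 *: (c *: z' + k) + m'), (- c^-1 *: k).
  split; [|exact: subspZ|].
    by apply: subspD => //; exact: subspZ.
  rewrite scalerDr scalerA mulVf // scale1r scaleNr /z'.
  by rewrite [RHS]addrAC addrK subrK.
Qed.

Lemma partial_complement_iter k N z : partial_complement A M N ->
  sumset M N (iter k A z) ->
  exists N', [/\ partial_complement A M N', N `<=` N' & sumset M N' z].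
Proof.
elim: k z => [|k IH] z hN; first by exists N; split.
rewrite iterSr => /(IH _ hN)[N1 [hN1 NN1 Az]].
have [N2 [hN2 NN2 z2]] := partial_complement_step hN1 Az.
by exists N2; split=> //; exact: subset_trans NN2.
Qed.

Lemma partial_complement_family k n (w : 'I_n -> X) N :
  partial_complement A M N -> (forall i, sumset M N (iter k A (w i))) ->
  exists N', [/\ partial_complement A M N', N `<=` N' &
                 forall i, sumset M N' (w i)].
Proof.
move=> hN hw.
suff [N' [hN' NN' w']] : exists N', [/\ partial_complement A M N', N `<=` N' &
    forall i, i \in enum 'I_n -> sumset M N' (w i)].
  by exists N'; split=> // i; apply: w'; rewrite mem_enum.
elim: (enum 'I_n) => [|i s [N1 [hN1 NN1 w1]]]; first by exists N; split.
have [N2 [hN2 NN2 w2]] := partial_complement_iter hN1 (sumset_monotone NN1 (hw i)).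
exists N2; split=> //; first exact: subset_trans NN2.
by move=> j; rewrite inE => /orP[/eqP -> //|/w1]; exact: sumset_monotone.
Qed.

End Extension.
End Algebra.

(** * Perturbation of a complemented core *)
Section Perturbation.
Context {R : realType} {X : completeNormedModType R[i]}.
Implicit Types (x y z : X) (M N : set X) (A B S F G Q : X -> X).

Definition complemented_core S : Prop :=
  closed (geometric_core S) /\ exists N,
    partial_complement S (geometric_core S) N /\
    forall x, sumset (geometric_core S) N x.

Lemma right_generalized_Drazin_invertibleE S : bop S ->
  right_generalized_Drazin_invertible S <-> complemented_core S.
Proof.
move=> hS; rewrite /right_generalized_Drazin_invertible.
rewrite analytical_coreE // quasinilpotent_partE.
split=> -[cK [N H]]; split=> //; exists N.
  case: H => /subsp_closed_subspace[sN cN] [KN KN0] SN qN.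
  split=> [|x]; last exact: KN.
  split=> // [x Nx|x Kx Nx]; first by apply: SN; exists x.
  by have : (geometric_core S `&` N) x by []; rewrite KN0.
case: H => -[sN cN SN qN KN0] KN; split=> //.
- exact/subsp_closed_subspace.
- split=> [x|]; first exact: KN.
  apply/seteqP; split=> [x [Kx Nx]|_ ->]; first exact: KN0.
  by split; [exact: (geometric_core_subsp hS).1|exact: sN.1].
- by move=> _ [x Nx <-]; exact: SN.
Qed.

(** The operator [Q] is the Fitting projection of [F], [P] the complementary one,
    and [r] inverts [A] on the range of [A^a] inside the range of [F]. *)
Section Setting.
Context (S F : X -> X).
Context (hS : bop S) (hF : bop F) (SF : commut S F).
Let A x := S x + F x.

Context (p : nat) (Q : X -> X) (hQ : bop Q).
Context (Qc : forall G, bop G -> commut G F -> commut G Q).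
Context (QF : forall x, range F (Q x)) (Q0 : forall x, F x = 0 -> Q x = 0).
Context (FQ : forall x, iter p F (x - Q x) = 0 /\ Q (Q x) = Q x).
Let P x := x - Q x.

Context (a : nat) (r : X -> X) (hr : bop r).
Context (rc : forall G, bop G -> commut G A -> commut G r).
Context (aE : forall x, range F x -> iter a A x = A (r (iter a A x))).

Let hA : bop A. Proof. exact: bop_add. Qed.
Let hP : bop P. Proof. exact: bop_sub bop_id hQ. Qed.
Let FA : commut F A. Proof. by move=> x; rewrite /A bopD // SF. Qed.
Let AS : commut A S. Proof. by move=> x; rewrite /A bopD // SF. Qed.
Let SQ : commut S Q. Proof. exact: Qc. Qed.
Let AQ : commut A Q. Proof. exact: Qc hA (commut_sym FA). Qed.
Let FQc : commut F Q. Proof. exact: Qc. Qed.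
Let SP : commut S P. Proof. by move=> x; rewrite /P bopB // SQ. Qed.
Let AP : commut A P. Proof. by move=> x; rewrite /P bopB // AQ. Qed.
Let FP : commut F P. Proof. by move=> x; rewrite /P bopB // FQc. Qed.
Let Ar : commut A r. Proof. exact: rc. Qed.
Let Qr : commut Q r. Proof. exact/(rc hQ)/commut_sym. Qed.
Let FPx x : iter p F (P x) = 0. Proof. by case: (FQ x). Qed.
Let QQ x : Q (Q x) = Q x. Proof. by case: (FQ x). Qed.
Let QP x : Q (P x) = 0. Proof. by rewrite /P bopB // QQ subrr. Qed.
Let P_id x : Q x = 0 -> P x = x. Proof. by rewrite /P => ->; rewrite subr0. Qed.
Let splitPQ x : P x + Q x = x. Proof. exact: subrK. Qed.

(** [S] and [A] differ by [F], which is nilpotent on the kernel of [Q]. *)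
Lemma core_on_nilpotent_part y : Q y = 0 ->
  geometric_core A y <-> geometric_core S y.
Proof.
move=> Qy; split.
  by apply: (geometric_core_nilpotent (P := P) (p := p)) => //;
    exact: P_id.
move=> Sy; apply: (@geometric_core_nilpotent _ _ A (fun x => - F x) P p) => //.
- exact: bop_opp.
- by move=> x; rewrite bopN // FA.
- by move=> x; rewrite bopN // FP.
- by move=> x; exact: iter_opp.
- exact: P_id.
- by rewrite (_ : (fun x => _) = S) //; apply/funext => x; rewrite /A addrK.
Qed.

(** This will turn out to be the analytical core of [A]. The second condition puts
    [Q x] into the part where [A] is invertible; it is an equation so that the set
    is visibly closed. *)
Definition perturbed_core : set X :=
  [set x | geometric_core S (P x) /\ A (r (Q x)) - Q x = 0].

Let sK := geometric_core_subsp hS.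

Lemma perturbed_core_subsp : subsp perturbed_core.
Proof.
split.
  by split; rewrite !(bop0 hP, bop0 hQ, bop0 hr, bop0 hA) ?subrr //; exact: sK.1.
move=> c x y [Px Qx] [Py Qy]; split.
  by rewrite bopD // bopZ //; exact: sK.2.
rewrite !(bopD _ _ hQ, bopD _ _ hr, bopD _ _ hA, bopZ _ _ hQ, bopZ _ _ hr, bopZ _ _ hA).
by rewrite opprD addrACA -scalerBr Qx Qy scaler0 addr0.
Qed.

Lemma perturbed_core_closed :
  closed (geometric_core S) -> closed perturbed_core.
Proof.
move=> cK; apply: closedI; first exact: closed_bop_preimage.
by apply: closed_bop_ker; apply: bop_sub => //; do 2!apply: bop_comp => //.
Qed.

Lemma perturbed_core_nilpotent_part x :
  Q x = 0 -> geometric_core S x -> perturbed_core x.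
Proof. by move=> Qx Sx; split; rewrite ?P_id // Qx (bop0 hr) (bop0 hA) subrr. Qed.

Lemma perturbed_core_sub : perturbed_core `<=` geometric_core A.
Proof.
move=> x [Sx /eqP]; rewrite subr_eq0 => /eqP Qx; rewrite -(splitPQ x).
apply: subspD; first exact: geometric_core_subsp.
  exact/core_on_nilpotent_part.
exact: (geometric_core_fixed hr).
Qed.

(** The orbit given by [core_on_nilpotent_part] lifts [P x], after projection to
    the kernel of [Q]; [r] lifts [Q x]. *)
Lemma perturbed_core_lift x : perturbed_core x ->
  exists2 y, perturbed_core y & A y = x.
Proof.
move=> [Sx /eqP]; rewrite subr_eq0 => /eqP Qx.
have /(core_on_nilpotent_part (QP x))/(geometric_core_lift 1)[y Ay /= yx] := Sx.
have Py : geometric_core S (P y).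
  apply/core_on_nilpotent_part; first exact: QP.
  by apply: geometric_core_commut.
exists (P y + r (Q x)); last first.
  by rewrite bopD // AP yx Qx (P_id (QP x)) splitPQ.
apply: subspD; first exact: perturbed_core_subsp.
  exact: perturbed_core_nilpotent_part.
have QrQ : Q (r (Q x)) = r (Q x) by rewrite Qr QQ.
split; first by rewrite /P QrQ subrr; exact: sK.1.
by rewrite QrQ Ar Qx subrr.
Qed.

Context (N : set X).
Context (hN : partial_complement S (geometric_core S) N).
Context (KN : forall x, sumset (geometric_core S) N x).
Context (d : nat) (dE : forall x, range F x -> qnil S x -> iter d S x = 0).

Definition kernel_part : set X := N `&` [set x | F x = 0].

Lemma kernel_part_complement :
  partial_complement A perturbed_core kernel_part.
Proof.
have [sN cN SN qN NK] := hN.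
split.
- split; first by split; [exact: sN.1|exact: bop0].
  move=> c x y [Nx Fx] [Ny Fy]; split; first exact: sN.2.
  by rewrite /= bopD // bopZ // Fx Fy scaler0 addr0.
- by apply: closedI => //; exact: closed_bop_ker.
- move=> x [Nx Fx]; rewrite /A Fx addr0; split; first exact: SN.
  by rewrite /= -SF Fx bop0.
- move=> x [Nx Fx] e e0; have [C C0 hC] := qN _ Nx e e0; exists C => // n.
  suff -> : iter n A x = iter n S x by [].
  elim: n => // n IH.
  by rewrite !iterS IH /A (commut_iter n (commut_sym SF)) Fx (bop0 (bop_iter n hS)) addr0.
- move=> x [Sx _] [Nx Fx]; apply: NK => //.
  by rewrite -(P_id (Q0 Fx)).
Qed.

(** The component in [N] of a vector enters the kernel of [F] after [d] steps:
    [F (S^d n) = S^d (F n)], and [F n] is a quasinilpotent vector of the finite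
    dimensional range of [F]. *)
Lemma iter_nilpotent_part y : Q y = 0 ->
  sumset perturbed_core kernel_part (iter d S y).
Proof.
move=> Qy; have [sN cN SN qN NK] := hN.
have [k [n [Kk Nn yE]]] := KN y.
have Nd : kernel_part (iter d S n).
  split; first by elim: (d) => // i; exact: SN.
  rewrite /= (commut_iter d (commut_sym SF)); apply: dE; first by exists n.
  by apply: qnil_commut => //; exact: qN.
exists (iter d S (P k)), (iter d S n); split=> //.
  apply: perturbed_core_nilpotent_part.
    by rewrite (commut_iter d (commut_sym SQ)) QP (bop0 (bop_iter d hS)).
  apply: geometric_core_commut; [exact: bop_iter|exact/commut_sym/commut_iter|].
  by apply: geometric_core_commut.
rewrite -[in LHS](P_id Qy) yE (bopD _ _ hP) (bopD _ _ (bop_iter d hS)); congr (_ + _).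
rewrite -(commut_iter d (commut_sym SP)) P_id //.
by apply: Q0; case: Nd.
Qed.

(** On the kernel of [Q] one has [A^p = S G], so [A^(d p) = S^d G^d] and
    [iter_nilpotent_part] applies; on the range of [Q], [A^a] reaches the part
    where [A] is invertible. *)
Lemma iter_in_sumset : exists D, forall x,
  sumset perturbed_core kernel_part (iter D A x).
Proof.
have [sN0 _ AN0 _ _] := kernel_part_complement.
have sM := perturbed_core_subsp; have sU := sumset_subsp sM sN0.
have AU n x : sumset perturbed_core kernel_part x ->
    sumset perturbed_core kernel_part (iter n A x).
  move=> Ux; elim: n => // n [m [k [[Pm Qm] Nk mk]]]; rewrite iterS mk.
  exists (A m), (A k); split; [split|exact: AN0|exact: bopD].
    by rewrite -AP; exact: geometric_core_commut hA AS Pm.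
  by rewrite -AQ -Ar -bopB // Qm bop0.
have [G [hG Gc pE]] := iter_add_factor p hS hF SF.
have SG : commut S G by exact: Gc.
have QG : commut Q G by apply: Gc => //; exact: commut_sym.
have pGE y : Q y = 0 -> iter p A y = S (G y).
  by move=> Qy; rewrite pE -[in iter p F y](P_id Qy) FPx addr0.
have pdE i y : Q y = 0 -> iter (i * p) A y = iter i S (iter i G y).
  move=> Qy; elim: i => // i IH.
  have Qi : Q (iter i S (iter i G y)) = 0.
    rewrite (commut_iter i (commut_sym SQ)) (commut_iter i QG) Qy.
    by rewrite (bop0 (bop_iter i hG)) (bop0 (bop_iter i hS)).
  rewrite mulSn iterD IH pGE // (iterS i S) (iterS i G); congr S.
  by rewrite (commut_iter i (commut_sym SG)).
exists (a + d * p)%N => x.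
rewrite -(splitPQ x) (bopD _ _ (bop_iter _ hA)); apply: subspD => //.
  rewrite iterD; apply: AU; rewrite pdE ?QP //; apply: iter_nilpotent_part.
  by rewrite (commut_iter d QG) QP (bop0 (bop_iter d hG)).
rewrite addnC iterD; apply: AU.
exists (iter a A (Q x)), 0; split; [split|exact: sN0.1|by rewrite addr0].
  rewrite /P (commut_iter a (commut_sym AQ)) QQ subrr; exact: sK.1.
by rewrite (commut_iter a (commut_sym AQ)) QQ -aE // subrr.
Qed.

(** A vector [b] common to [K(A)] and [N'] is [A^D c] with [c] again in both. As
    [A^D] maps [N'] into [kernel_part], [b] lies in [N] and in the kernel of [F],
    where [K(A)] and [K(S)] coincide; but [K(S)] meets [N] only in zero. *)
Lemma geometric_core_perturbed D N' :
  (forall x, sumset perturbed_core kernel_part (iter D A x)) ->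
  partial_complement A perturbed_core N' -> kernel_part `<=` N' ->
  (forall x, sumset perturbed_core N' x) ->
  geometric_core A = perturbed_core.
Proof.
move=> hD [sN' _ AN' _ MN'] NN' U'; have sM := perturbed_core_subsp.
have sA := geometric_core_subsp hA.
apply/seteqP; split; last exact: perturbed_core_sub.
have AM x n : perturbed_core x -> perturbed_core (iter n A x).
  move=> Mx; elim: n => // n [Pm Qm]; split; rewrite iterS.
    by rewrite -AP; exact: geometric_core_commut hA AS Pm.
  by rewrite -AQ -Ar -bopB // Qm bop0.
have AN n x : N' x -> N' (iter n A x).
  by move=> Nx; elim: n => // n; exact: AN'.
suff key b : geometric_core A b -> N' b -> b = 0.
  move=> x Ax; have [m [b [Mm Nb xE]]] := U' x.
  have Ab : geometric_core A b.
    have -> : b = x - m by rewrite xE addrC addKr.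
    by apply: subspB => //; exact: perturbed_core_sub.
  by rewrite xE (key _ Ab Nb) addr0.
move=> Ab Nb; have [y Ay yb] := geometric_core_lift D Ab.
have [m [c [Mm Nc yE]]] := U' y.
have Ac : geometric_core A c.
  have -> : c = y - m by rewrite yE addrC addKr.
  by apply: subspB => //; exact: perturbed_core_sub.
have bc : b = iter D A c.
  apply/eqP; rewrite -subr_eq0 -yb yE (bopD _ _ (bop_iter D hA)) addrK.
  apply/eqP; apply: MN'; first exact: AM.
  have -> : iter D A m = b - iter D A c.
    by rewrite -yb yE (bopD _ _ (bop_iter D hA)) addrK.
  by apply: subspB => //; exact: AN.
have [m' [k [Mm' Nk bE]]] := hD c.
have m'0 : m' = 0.
  apply: MN' => //; have -> : m' = b - k by rewrite bc bE addrK.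
  by apply: subspB => //; exact: NN'.
have {bE m'0} bk : b = k by rewrite bc bE m'0 add0r.
have [_ _ _ _ KN0] := hN; case: Nk; rewrite -bk => Nb' Fb.
by apply: KN0 => //; apply/core_on_nilpotent_part => //; exact: Q0.
Qed.

(** The vectors to be adjoined to [kernel_part] are generators [e] of the range of
    [F], which contains the range of [Q], and the projections [P (u i)] of
    generators of [N] modulo the kernel of [F]. *)
Lemma perturbed_complement n (e : 'I_n -> X) :
  (forall x, range F x -> exists c : 'I_n -> R[i], x = \sum_i c i *: e i) ->
  exists N', [/\ partial_complement A perturbed_core N', kernel_part `<=` N' &
    forall x, sumset perturbed_core N' x].
Proof.
move=> espan; have [sN _ _ _ _] := hN; have sM := perturbed_core_subsp.
have [m [u [Nu hu]]] : exists m (u : 'I_m -> X), (forall i, N (u i)) /\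
    forall x, N x -> exists c : 'I_m -> R[i], F (x - \sum_i c i *: u i) = 0.
  by apply: (@finite_rank_generators _ _ n F e) => // x _; apply: espan; exists x.
have [D hD] := iter_in_sumset.
have [N1 [hN1 NN1 e1]] := partial_complement_family hA sM perturbed_core_lift
  kernel_part_complement (fun i => hD (e i)).
have [N2 [hN2 N12 u2]] := partial_complement_family hA sM perturbed_core_lift
  hN1 (fun i => sumset_monotone NN1 (hD (P (u i)))).
have NN2 := subset_trans NN1 N12.
exists N2; split=> // x; have [sN2 _ _ _ _] := hN2.
have sU := sumset_subsp sM sN2.
rewrite -(splitPQ x); apply: subspD => //; last first.
  have [c ->] := espan _ (QF x); apply: subsp_sum => // i; apply: subspZ => //.
  exact: sumset_monotone (e1 i).
have [k [b [Kk Nb ->]]] := KN x; rewrite (bopD _ _ hP); apply: subspD => //.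
  exists (P k), 0; split; [|exact: sN2.1|by rewrite addr0].
  apply: perturbed_core_nilpotent_part; first exact: QP.
  by apply: geometric_core_commut.
have [c Fc] := hu _ Nb; rewrite -(subrK (\sum_i c i *: u i) b).
rewrite (bopD _ _ hP) (P_id (Q0 Fc)); apply: subspD => //.
  exists 0, (b - \sum_i c i *: u i); split; [exact: sM.1| |by rewrite add0r].
  apply: NN2; split=> //; apply: subspB => //; apply: subsp_sum => // i.
  exact: subspZ.
rewrite (bop_lincomb _ _ hP); apply: subsp_sum => // i; exact: subspZ.
Qed.

End Setting.

Lemma complemented_core_perturbation S F : bop S -> bop F -> commut S F ->
  finite_dimensional (range F) ->
  complemented_core S -> complemented_core (fun x => S x + F x).
Proof.
move=> hS hF SF fF [cK [N [hN KN]]].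
have [p [Q [hQ Qc QF Q0 FQ]]] := finite_rank_projection hF fF.
have hA := bop_add hS hF.
have [|a [r [hr rc aE]]] := fitting hA fF.
  move=> _ [x _ <-]; exists (S x + F x) => //.
  by rewrite bopD // SF.
have [|d dE] := qnil_finite_dimensional hS fF.
  by move=> _ [x _ <-]; exists (S x); rewrite // SF.
have [n [e [_ espan]]] := fF.
have [D hD] := iter_in_sumset hS hF SF hQ Qc QF Q0 FQ hr rc aE hN KN dE.
have [N' [hN' NN' U']] :=
  perturbed_complement hS hF SF hQ Qc QF Q0 FQ hr rc aE hN KN dE espan.
have EM := geometric_core_perturbed hS hF SF hQ Qc Q0 FQ hr rc hN hD hN' NN' U'.
rewrite /complemented_core EM; split; last by exists N'.
exact: perturbed_core_closed.
Qed.

End Perturbation.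

Theorem proposition3p15 (R : realType) (X : completeNormedModType R[i])
    (X_infinite_dimensional : ~ finite_dimensional [set: X])
    (T F : {linear X -> X})
    (T_bounded : bounded_operator T)
    (F_bounded : bounded_operator F)
    (F_finite_rank : finite_rank F)
    (TF_comm : T \o F = F \o T) :
  rgD_spectrum (T \+ F) = rgD_spectrum T.
Proof.
have bopE (B : {linear X -> X}) : bounded_operator B -> bop B.
  move=> [C hC]; split=> [c x y|]; first exact: linearP.
  exists `|C| => // x; apply: (le_trans (hC x)).
  by rewrite ler_wpM2r ?rnorm_ge0 // ler_norm.
have hT := bopE _ T_bounded; have hF := bopE _ F_bounded.
have TF : commut T F by move=> x; exact: (congr1 (fun f => f x) TF_comm).
have hS l : bop (fun x => l *: x - T x) := bop_sub (bop_scale l bop_id) hT.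
have hA l : bop (fun x => l *: x - (T x + F x)).
  exact: bop_sub (bop_scale l bop_id) (bop_add hT hF).
have hFN := bop_opp hF.
have range_opp : range (fun x => - F x) = range F.
  apply/seteqP; split=> _ [x _ <-]; exists (- x) => //; rewrite linearN ?opprK //.
have lTF l : commut (fun x => l *: x - T x) F.
  by move=> x; rewrite (bopB _ _ hF) (bopZ _ _ hF) TF.
apply/seteqP; split=> l /= nl; move: nl; apply: contra_not.
  move=> /(right_generalized_Drazin_invertibleE (hS l)) cS.
  apply/(right_generalized_Drazin_invertibleE (hA l)).
  rewrite (_ : (fun x => _) = fun x => (l *: x - T x) + (- F x)); last first.
    by apply/funext => x; rewrite opprD addrA.
  apply: complemented_core_perturbation => //; last by rewrite range_opp.
  by move=> x; rewrite [LHS](bopN (F x) (hS l)) [X in - X]lTF.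
move=> /(right_generalized_Drazin_invertibleE (hA l)) cA.
apply/(right_generalized_Drazin_invertibleE (hS l)).
rewrite (_ : (fun x => _) = fun x => (l *: x - (T x + F x)) + F x); last first.
  by apply/funext => x; rewrite opprD addrA subrK.
apply: complemented_core_perturbation => // x.
by rewrite (bopB _ _ hF) (bopZ _ _ hF) (bopD _ _ hF) TF.
Qed.
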